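(* Let $G=(V,E)$ be a maximal chain mixed graph (CMG) and let $\mathcal{J}$ be an independence model over $V$ that is a compositional graphoid. Then $\mathcal{J}$ satisfies the pairwise Markov property (P) with respect to $G$, that is, $\langle \{i\},\{j\}\,|\,\mathrm{ant}(\{i,j\})\rangle\in\mathcal{J}$ for every pair of distinct non-adjacent nodes $i,j\in V$, if and only if $\mathcal{J}$ satisfies the global Markov property with respect to $G$, that is, for all pairwise disjoint $A,B,C\subseteq V$, $A\perp B\,|\,C$ in $G$ implies $\langle A,B\,|\,C\rangle\in\mathcal{J}$.
   Context: Graphs: a graph $G=(V,E)$ has a finite node set $V$ and edges of four possible types: lines (solid, undirected), arrows ($i\to j$), arcs ($i\leftrightarrow j$), and dotted lines (undirected). There are no loops, but multiple edges between the same two nodes are allowed. Two nodes are adjacent if they are the endpoints of some edge. A walk is a list $\langle i_0,e_1,i_1,\dots,e_n,i_n\rangle$ of nodes and edges with $e_m$ having endpoints $i_{m-1},i_m$; nodes and edges may repeat. Sections and separation: a section of a walk is a maximal subwalk consisting only of solid lines (possibly a single node); a walk decomposes uniquely into sections. A section is an endpoint section if it contains an endpoint (first or last position) of the walk, otherwise an inner section. An inner section is a collider section if, of the two edges of the walk adjacent to it, both have an arrowhead pointing to the section, or one has an arrowhead pointing to the section and the other is a dotted line. All other sections, including endpoint sections, are non-collider sections. A walk is connecting given $C$ if all its collider sections intersect $C$ and all its non-collider sections are disjoint from $C$. For pairwise disjoint $A,B,C\subseteq V$, $A\perp B\,|\,C$ means there is no connecting walk given $C$ between a node of $A$ and a node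 of $B$. The independence model induced by $G$ is $\mathcal{J}(G)=\{\langle A,B\,|\,C\rangle : A\perp B\,|\,C\}$. CMGs and anteriors: a walk from $i$ to $j$ is semi-directed if it has at least one arrow, no arcs, and every arrow on it points in the direction from $i$ to $j$. A CMG is a graph without dotted lines and without semi-directed cycles (a cycle is a closed walk with at least two edges and no repeated node except its coinciding first and last nodes). In a CMG, a walk from $i$ to $j$ is anterior if it is semi-directed from $i$ to $j$ or consists only of lines. For $i\neq j$, $i$ is an anterior of $j$ if there is an anterior walk from $i$ to $j$; $\mathrm{ant}(j)$ is the set of anteriors of $j$, and $\mathrm{ant}(A)=\bigcup_{j\in A}\mathrm{ant}(j)\setminus A$. Maximality: $G$ is maximal if adding an edge between any two non-adjacent nodes of $G$ changes the independence model $\mathcal{J}(G)$. Independence models: an independence model $\mathcal{J}$ over a finite set $V$ is a set of triples $\langle A,B\,|\,C\rangle$ of pairwise disjoint subsets of $V$ ($C$ may be empty) that contains all triples $\langle \varnothing,B\,|\,C\rangle$ and $\langle A,\varnothing\,|\,C\rangle$. It is a compositional graphoid if for all pairwise disjoint $A,B,C,D\subseteq V$: (S1, symmetry) $\langle A,B|C\rangle\in\mathcal{J}\iff\langle B,A|C\rangle\in\mathcal{J}$; (S2, decomposition) $\langle A,B\cup D|C\rangle\in\mathcal{J}$ implies $\langle A,B|C\rangle,\langle A,D|C\rangle\in\mathcal{J}$; (S3, weak union) $\langle A,B\cup D|C\rangle\in\mathcal{J}$ implies $\langle A,B|C\cup D\rangle,\langle A,D|C\cup B\rangle\in\mathcal{J}$;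 (S4, contraction) $\langle A,B|C\cup D\rangle,\langle A,D|C\rangle\in\mathcal{J}$ if and only if $\langle A,B\cup D|C\rangle\in\mathcal{J}$; (S5, intersection) $\langle A,B|C\cup D\rangle,\langle A,D|C\cup B\rangle\in\mathcal{J}$ implies $\langle A,B\cup D|C\rangle\in\mathcal{J}$; (S6, composition) $\langle A,B|C\rangle,\langle A,D|C\rangle\in\mathcal{J}$ implies $\langle A,B\cup D|C\rangle\in\mathcal{J}$. *)

(* Defs.v *)
From HB Require Import structures.
From mathcomp Require Import all_boot.
From mathcomp Require Import boolp.

Set Implicit Arguments.
Unset Strict Implicit.
Unset Printing Implicit Defensive.

Inductive edge_type := Line | Arrow | Arc | Dotted.

(* Edges are objects of their own, so any number of parallel edges, of equal
   or different types, is allowed.  An [Arrow] points from [end1] to [end2];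
   for the other three types the order of the two ends carries no meaning. *)
Record graph (V : finType) := Graph {
  edge : Type;
  etype : edge -> edge_type;
  end1 : edge -> V;
  end2 : edge -> V;
  loopless : forall e, end1 e != end2 e
}.

Section Graphs.
Variables (V : finType) (G : graph V).
Implicit Types (e f : edge G) (i j k x y : V).

Definition is_line e := if etype e is Line then true else false.
Definition is_arrow e := if etype e is Arrow then true else false.
Definition is_arc e := if etype e is Arc then true else false.
Definition is_dotted e := if etype e is Dotted then true else false.

Definition joins e i j : bool :=
  ((end1 e == i) && (end2 e == j)) || ((end1 e == j) && (end2 e == i)).

Definition adjacent i j : Prop := exists e, joins e i j.

Definition arrowhead_at e x : bool :=
  match etype e with
  | Arrow => end2 e == x
  | Arc => (end1 e == x) || (end2 e == x)
  | _ => false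
  end.

(* The walk <i_0, e_1, i_1, ..., e_n, i_n> is given by its first node i_0
   and the list [:: (e_1, i_1); ...; (e_n, i_n)]. *)
Definition steps := seq (edge G * V).
Implicit Types (w p l q : steps).

Fixpoint is_walk i w j : Prop :=
  match w with
  | [::] => i = j
  | (e, k) :: w' => joins e i k /\ is_walk k w' j
  end.

Definition all_lines w : bool := all (fun s => is_line s.1) w.

Definition starts_with_line w : bool :=
  if w is (e, _) :: _ then is_line e else false.

Definition ends_with_line w : bool := starts_with_line (rev w).

(* The walk is cut as w = p ++ l ++ q, and l is a maximal run of lines. The
   section consists of l together with the node reached at the end of p; when
   l is empty it is that single node. *)
Definition is_section w p l q : Prop :=
  [/\ w = p ++ l ++ q, all_lines l, ~~ ends_with_line p
    & ~~ starts_with_line q].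

Definition section_nodes i p l : seq V := last i (unzip2 p) :: unzip2 l.

(* The section is an endpoint section iff p or q is empty. Otherwise the two
   edges of the walk adjacent to it are the last edge e of p, which enters it
   at x, and the first edge f of q, which leaves it at y. *)
Definition collider_section p l q : bool :=
  match rev p, q with
  | (e, x) :: _, (f, _) :: _ =>
      let y := last x (unzip2 l) in
      [|| arrowhead_at e x && arrowhead_at f y,
          arrowhead_at e x && is_dotted f
        | is_dotted e && arrowhead_at f y]
  | _, _ => false
  end.

Definition connecting (C : {set V}) i w : Prop :=
  forall p l q, is_section w p l q ->
    if collider_section p l q
    then exists2 k, k \in section_nodes i p l & k \in C
    else forall k, k \in section_nodes i p l -> k \notin C.

Definition separated (A B C : {set V}) : Prop :=
  ~ exists i j w, [/\ i \in A, j \in B, is_walk i w j & connecting C i w].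

Definition semi_directed w : bool :=
  [&& has (fun s => is_arrow s.1) w,
      all (fun s => ~~ is_arc s.1) w
    & all (fun s => is_arrow s.1 ==> (end2 s.1 == s.2)) w].

Definition is_cycle i w : Prop :=
  [/\ is_walk i w i, 2 <= size w & uniq (unzip2 w)].

Definition CMG : Prop :=
  (forall e, ~~ is_dotted e) /\
  ~ exists i w, is_cycle i w /\ semi_directed w.

Definition is_anterior i j : Prop :=
  i <> j /\ exists w, is_walk i w j /\ (semi_directed w || all_lines w).

Definition ant1 j : {set V} := [set i | `[< is_anterior i j >]].

Definition ant (A : {set V}) : {set V} := (\bigcup_(j in A) ant1 j) :\: A.

End Graphs.

Definition add_edge (V : finType) (G : graph V) (t : edge_type) (i j : V)
    (ij : i != j) : graph V :=
  @Graph V (option (edge G))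
    (fun o => if o is Some e then etype e else t)
    (fun o => if o is Some e then end1 e else i)
    (fun o => if o is Some e then end2 e else j)
    (fun o => match o with Some e => loopless e | None => ij end).

Section IndependenceModels.
Variable V : finType.
Implicit Types A B C D : {set V}.

Definition disjoint3 A B C : bool :=
  [&& [disjoint A & B], [disjoint A & C] & [disjoint B & C]].

Definition disjoint4 A B C D : bool :=
  [&& disjoint3 A B C, [disjoint A & D], [disjoint B & D] & [disjoint C & D]].

(* The triple (A, B, C) stands for < A, B | C >. *)
Definition triples := {set {set V} * {set V} * {set V}}.
Implicit Type J : triples.

Definition independence_model J : Prop :=
  [/\ forall A B C, (A, B, C) \in J -> disjoint3 A B C,
      forall B C, [disjoint B & C] -> (set0, B, C) \in J
    & forall A C, [disjoint A & C] -> (A, set0, C) \in J].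

Definition symmetry_axiom J : Prop := forall A B C, disjoint3 A B C ->
  (A, B, C) \in J <-> (B, A, C) \in J.

Definition decomposition_axiom J : Prop := forall A B C D, disjoint4 A B C D ->
  (A, B :|: D, C) \in J -> (A, B, C) \in J /\ (A, D, C) \in J.

Definition weak_union_axiom J : Prop := forall A B C D, disjoint4 A B C D ->
  (A, B :|: D, C) \in J ->
  (A, B, C :|: D) \in J /\ (A, D, C :|: B) \in J.

Definition contraction_axiom J : Prop := forall A B C D, disjoint4 A B C D ->
  (A, B, C :|: D) \in J /\ (A, D, C) \in J <-> (A, B :|: D, C) \in J.

Definition intersection_axiom J : Prop := forall A B C D, disjoint4 A B C D ->
  (A, B, C :|: D) \in J /\ (A, D, C :|: B) \in J -> (A, B :|: D, C) \in J.

Definition composition_axiom J : Prop := forall A B C D, disjoint4 A B C D ->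
  (A, B, C) \in J /\ (A, D, C) \in J -> (A, B :|: D, C) \in J.

Definition compositional_graphoid J : Prop :=
  [/\ symmetry_axiom J, decomposition_axiom J & weak_union_axiom J] /\
  [/\ contraction_axiom J, intersection_axiom J & composition_axiom J].

Definition induced_model (G : graph V) : triples :=
  [set T | `[< let: (A, B, C) := T in
               disjoint3 A B C /\ separated G A B C >]].

(* The new edge may be of any of the four types and, the pair being ordered,
   an arrow may point either way. *)
Definition maximal (G : graph V) : Prop :=
  forall (i j : V) (ij : i != j) (t : edge_type),
    ~ adjacent G i j -> induced_model (add_edge G t ij) <> induced_model G.

Definition pairwise_markov (G : graph V) J : Prop :=
  forall i j, i != j -> ~ adjacent G i j ->
    ([set i], [set j], ant G [set i; j]) \in J.

Definition global_markov (G : graph V) J : Prop :=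
  forall A B C, disjoint3 A B C -> separated G A B C -> (A, B, C) \in J.

End IndependenceModels.

(* Main.v *)
Require Import Defs.
From mathcomp Require Import all_boot.
From mathcomp Require Import boolp.

Set Implicit Arguments.
Unset Strict Implicit.
Unset Printing Implicit Defensive.

(** Write [u <= v] if [u = v] or [u] is an anterior of [v].  For a down-closed
    set [M], call two nodes of [M] linked if they are adjacent or joined by a
    walk inside [M] all of whose inner sections are colliders.

    Pairwise implies global.  By induction on down-closed [M], unlinked sets [A]
    and [B] are independent given the rest of [M]: by intersection it is enough
    to treat single nodes [u] and [v].  If [M] is generated by [u] and [v], this
    is the pairwise property.  Otherwise [M] has a maximal class T of [<=] away
    from [u] and [v]; a collider section inside T would link [u] to [v], so one
    of them is not linked to T, and the statement for [M :\: T] lifts to [M]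
    by composition or contraction followed by weak union.  If [C] separates [A]
    from [B], let [M] be generated by their union: a node of [M :\: C] linked to
    one that [A] reaches by a connecting walk is itself reached, so the
    reached and the unreached nodes of [M :\: C] are unlinked.

    Global implies pairwise.  If non-adjacent [i] and [j] are connected given
    their anteriors, they are linked inside the down-set M of [i] and [j].  If
    both extreme edges of such a walk are arcs, adding an arc between [i] and
    [j] creates no new connection; if one is an arrow from [i], then [i <= j]
    and the same holds for a new arrow from [i] to [j].  Both contradict
    maximality. *)

(** * Connecting walks as runs of an automaton *)

Section Automaton.
Variables (V : finType) (G : graph V).
Implicit Types (e f : edge G) (x y : V) (w p l q : steps G).

(* State of a walk read from left to right: h tells whether the current
   section was entered through an arrowhead, c whether it has met C so far. *)
Definition exit_ok (h c : bool) e x := if h && arrowhead_at e x then c else ~~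
  c.

(** A section is judged only when it is left. At the end of the walk it is an endpoint section,
    hence a non-collider, which is why the empty walk demands [~~ c]. *)
Fixpoint good (C : {set V}) (h c : bool) x w : bool :=
  match w with
  | [::] => ~~ c
  | (e, y) :: w' =>
      if is_line e then good C h (c || (y \in C)) y w'
      else exit_ok h c e x && good C (arrowhead_at e y) (y \in C) y w'
  end.

(** States attained on walks from [A]. The flag starts at [false] because an endpoint section never
    counts as a collider. Later proofs reroute walks by moving between states, without handling
    lists of edges. *)
Inductive reach (A C : {set V}) : V -> bool -> bool -> Prop :=
| reach_start a : a \in A -> reach A C a false (a \in C)
| reach_line x y h c e : reach A C x h c -> is_line e -> joins e x y ->
    reach A C y h (c || (y \in C))
| reach_exit x y h c e : reach A C x h c -> ~~ is_line e -> joins e x y ->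
    exit_ok h c e x -> reach A C y (arrowhead_at e y) (y \in C).

Lemma good_reach A C w x h c j : reach A C x h c -> is_walk x w j ->
  good C h c x w -> exists h', reach A C j h' false.
Proof.
elim: w x h c => [|[e y] w IH] x h c rx /= => [<- /negbTE c0|[exy wk]].
  by exists h; rewrite -c0.
case: ifP => [el|/negbT el]; first exact: IH (reach_line rx el exy) wk.
by case/andP => ex; apply: IH (reach_exit rx el exy ex) wk.
Qed.

(** Generalized over the continuation [w], since the induction moves each step of [reach] to its
    front. *)
Lemma reach_good A C x h c : reach A C x h c ->
  forall w j, is_walk x w j -> good C h c x w ->
  exists a w', [/\ a \in A, is_walk a w' j & good C false (a \in C) a w'].
Proof.
elim=> {x h c} [a aA|x y h c e _ IH el exy|x y h c e _ IH el exy ex] w j wk g.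
- by exists a, w.
- by apply: (IH ((e, y) :: w) j) => //=; rewrite el.
- by apply: (IH ((e, y) :: w) j) => //=; rewrite (negbTE el) ex.
Qed.

Definition entry (h : bool) p :=
  if rev p is (e, x) :: _ then arrowhead_at e x else h.

Definition exit_head y q :=
  if q is (f, _) :: _ then arrowhead_at f y else false.

(* [connecting], but with the first section counted as entered through an
   arrowhead when [h] holds. *)
Definition connecting_from (C : {set V}) h i w : Prop :=
  forall p l q, is_section w p l q ->
    if entry h p && exit_head (last i (section_nodes i p l)) q
    then has (mem C) (section_nodes i p l)
    else ~~ has (mem C) (section_nodes i p l).

Lemma is_section_lines l0 p l q : all_lines l0 ->
  is_section l0 p l q -> [/\ p = [::], l = l0 & q = [::]].
Proof.
move=> L0 [E Ll np nq]; move: L0;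
  rewrite E /all_lines !all_cat => /and3P[Lp _ Lq].
have -> : p = [::].
  case/lastP: p np Lp {E} => // p [e x]; rewrite /ends_with_line rev_rcons /=.
  by move=> /negbTE ne; rewrite all_rcons /= ne.
by case: q nq Lq {E} => [|[e x] q] /=; [rewrite cats0|move=> /negbTE->].
Qed.

Lemma lines_prefix_uniq l l' q q' : all_lines l -> all_lines l' ->
  ~~ starts_with_line q -> ~~ starts_with_line q' -> l ++ q = l' ++ q' ->
  l = l' /\ q = q'.
Proof.
elim: l l' => [|[e x] l IH] [|[e' x'] l'] //=.
- by move=> _ /andP[e'l _] nq _ E; rewrite E /= e'l in nq.
- by move=> /andP[el _] _ _ nq E; rewrite -E /= el in nq.
by move=> /andP[_ Ll] /andP[_ Ll'] nq nq' [-> -> /IH[]] // -> ->.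
Qed.

Lemma ends_with_line_cons s p :
  ends_with_line (s :: p) = if p is [::] then is_line s.1 else ends_with_line p.
Proof.
case/lastP: p => [|p s']; first by case: s.
rewrite /ends_with_line -rcons_cons !rev_rcons.
by case: (rcons p s') (size_rcons p s').
Qed.

(** Cutting at the first edge [f] that is not a line: a section is the initial run [l0] or lies
    wholly after [f]. *)
Lemma is_section_cat l0 f y w p l q : all_lines l0 -> ~~ is_line f ->
  is_section (l0 ++ (f, y) :: w) p l q <->
  [/\ p = [::], l = l0 & q = (f, y) :: w] \/
  exists2 p', p = l0 ++ (f, y) :: p' & is_section w p' l q.
Proof.
move=> L0 nf; split; last first.
  case=> [[-> -> ->]|[p' -> [-> Ll np nq]]]; first by split.
  split=> //; first by rewrite -catA.
  elim: (l0) => [|s l1 IH]; rewrite ?cat0s ?cat_cons ends_with_line_cons.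
    by case: p' np.
  by case: l1 IH.
case=> E Ll np nq; elim: l0 p L0 E np => [|s l0 IH] p /=.
  case: p => [_ /= E _|s' p _ /= [<- E] np].
    by left; case: (@lines_prefix_uniq l [::] q ((f, y) :: w)).
  right; exists p => //; split=> //; apply: contra np.
  by rewrite ends_with_line_cons; case: p {E}.
case/andP=> sl L0; case: p => [/= E _|s' p /= [<- E]].
  left; case: (@lines_prefix_uniq l (s :: l0) q ((f, y) :: w)) => //=.
  by rewrite sl.
rewrite ends_with_line_cons => np.
case: (IH p L0 E); first by case: p np {E}.
  by case=> p0 _ _; rewrite p0 sl in np.
by case=> p' -> sp; right; exists p'.
Qed.

Lemma section_nodes_cat i l0 f y p l :
  section_nodes i (l0 ++ (f, y) :: p) l = section_nodes y p l.
Proof. by rewrite /section_nodes /unzip2 map_cat /= last_cat. Qed.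

Lemma entry_cat h l0 f y p :
  entry h (l0 ++ (f, y) :: p) = entry (arrowhead_at f y) p.
Proof. by rewrite /entry rev_cat rev_cons; case: (rev p) => [|[]]. Qed.

Lemma connecting_from_lines (C : {set V}) h i l0 : all_lines l0 ->
  connecting_from C h i l0 <-> ~~ has (mem C) (i :: unzip2 l0).
Proof.
move=> L0; split=> [/(_ [::] l0 [::])|H p l q /is_section_lines[] // -> -> ->].
  by rewrite /= andbF; apply; split; rewrite ?cats0.
by rewrite /= andbF.
Qed.

Lemma connecting_from_cat (C : {set V}) h i l0 f y w :
  all_lines l0 -> ~~ is_line f ->
  connecting_from C h i (l0 ++ (f, y) :: w) <->
  exit_ok h (has (mem C) (i :: unzip2 l0)) f (last i (unzip2 l0)) /\
  connecting_from C (arrowhead_at f y) y w.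
Proof.
move=> L0 nf; split=> [H|[ex H] p l q /is_section_cat-/(_ L0 nf)].
  split=> [|p l q s].
    have := H [::] l0 ((f, y) :: w); rewrite /exit_ok /=.
    have s: is_section (l0 ++ (f, y) :: w) [::] l0 ((f, y) :: w) by [].
    by move/(_ s); case: ifP.
  have := H (l0 ++ (f, y) :: p) l q; rewrite section_nodes_cat entry_cat.
  by apply; apply/is_section_cat => //; right; exists p.
case=> [[-> -> ->]|[p' -> /H]]; first by move: ex; rewrite /exit_ok /=;
  case: ifP.
by rewrite section_nodes_cat entry_cat.
Qed.

(** [l0] is the part of the current section read so far; the automaton remembers only whether it met
    [C] and its last node. *)
Lemma connecting_from_good (C : {set V}) w h i l0 : all_lines l0 ->
  connecting_from C h i (l0 ++ w) <->
  good C h (has (mem C) (i :: unzip2 l0)) (last i (unzip2 l0)) w.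
Proof.
elim: w h i l0 => [|[f y] w IH] h i l0 L0.
  by rewrite cats0; apply: connecting_from_lines.
rewrite [good _ _ _ _ _]/=; case: ifP => [fl|/negbT nf].
  rewrite -cat_rcons IH; last by rewrite /all_lines all_rcons fl.
  by rewrite /unzip2 map_rcons last_rcons -rcons_cons has_rcons orbC.
rewrite connecting_from_cat //.
have := IH (arrowhead_at f y) y [::] isT; rewrite cat0s /= orbF => ->.
by split=> [[-> ->]|/andP[]].
Qed.

Hypothesis no_dotted : forall e, ~~ is_dotted e.

(** Without dotted lines a collider section is one with arrowheads on both sides. Endpoint sections
    fail this test because [entry false] and [exit_head] default to [false]. *)
Lemma connectingE (C : {set V}) i w :
  connecting C i w <-> connecting_from C false i w.
Proof.
suff H p l q : collider_section p l q =
    entry false p && exit_head (last i (section_nodes i p l)) q.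
  split=> cw p l q /cw; rewrite H; case: ifP => _.
  - by case=> k kn kC; apply/hasP; exists k.
  - by move=> nC; apply/hasPn => k /nC.
  - by case/hasP=> k kn kC; exists k.
  - by move/hasPn.
rewrite /collider_section /entry /section_nodes /exit_head.
case: (lastP p) => [|p' [e x]] //;
  rewrite rev_rcons /unzip2 map_rcons last_rcons.
case: q => [|[f z] q]; first by rewrite andbF.
by rewrite !(negbTE (no_dotted _)) andbF orbF.
Qed.

Lemma separatedP (A B C : {set V}) :
  separated G A B C <-> ~ exists2 j, j \in B & exists h, reach A C j h false.
Proof.
split=> nc; apply: contra_not nc.
  case=> j jB [h /reach_good/(_ [::] j)[] // i [w [iA wk g]]].
  exists i, j, w; split=> //; apply/connectingE/(@connecting_from_good _ _ _ _
    [::]) => //.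
  by rewrite /= orbF.
case=> i [j [w [iA jB wk /connectingE/(@connecting_from_good _ _ _ _ [::]
  isT)]]].
rewrite /= orbF => g; exists j => //.
exact: good_reach (reach_start C iA) wk g.
Qed.

End Automaton.

(** * Collider paths and reachability *)

Section Relations.
Variables (V : finType) (G : graph V).
Implicit Types (e f : edge G) (x y z : V) (A B C M S : {set V}).

Definition line x y : bool := `[< exists2 e : edge G, is_line e & joins e x y
  >].

Definition arrow x y : bool :=
  `[< exists2 e : edge G, is_arrow e & end1 e = x /\ end2 e = y >].

Definition arc x y : bool := `[< exists2 e : edge G, is_arc e & joins e x y >].

(** In a CMG, [connect step x y] means that [x] is [y] or an anterior of [y]. This is a preorder in
    which nodes joined by lines are equivalent. *)
Definition step x y := line x y || arrow x y.

Definition down S : {set V} := [set x | [exists s in S, connect step x s]].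

Definition into x s := arrow x s || arc x s.

(** No arrows: an arrow between two inner sections would have its tail at one of them, which would
    then not be a collider. *)
Definition inner M x y := [&& x \in M, y \in M & line x y || arc x y].

(* For [M] closed under [down], this holds iff some walk from [u] to [v] is
   connecting given [M :\: [set u; v]]. *)
Definition linked M u v : Prop :=
  adjacent G u v \/
  exists s t, [/\ s \in M, t \in M, into u s, into v t & connect (inner M) s t].

Lemma joinsC e x y : joins e x y = joins e y x.
Proof. by rewrite /joins orbC. Qed.

Lemma adjacentC x y : adjacent G x y -> adjacent G y x.
Proof. by case=> e; rewrite joinsC; exists e. Qed.

Lemma lineC x y : line x y = line y x.
Proof. by apply/asboolP/asboolP => -[e te]; rewrite joinsC; exists e. Qed.

Lemma arcC x y : arc x y = arc y x.
Proof. by apply/asboolP/asboolP => -[e te]; rewrite joinsC; exists e. Qed.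

Lemma line_adjacent x y : line x y -> adjacent G x y.
Proof. by case/asboolP=> e _ exy; exists e. Qed.

Lemma arc_adjacent x y : arc x y -> adjacent G x y.
Proof. by case/asboolP=> e _ exy; exists e. Qed.

Lemma arrow_adjacent x y : arrow x y -> adjacent G x y.
Proof. by case/asboolP=> e _ [<- <-]; exists e; rewrite /joins !eqxx. Qed.

Lemma innerC M x y : inner M x y = inner M y x.
Proof. by rewrite /inner lineC arcC andbCA. Qed.

Lemma inner_connectC M x y : connect (inner M) x y = connect (inner M) y x.
Proof. by apply: sym_connect_sym; apply: innerC. Qed.

Lemma linkedC M x y : linked M x y -> linked M y x.
Proof.
case=> [/adjacentC|[s [t [sM tM xs yt c]]]]; first by left.
by right; exists t, s; rewrite inner_connectC.
Qed.

Lemma linkedS M (N : {set V}) x y : M \subset N -> linked M x y -> linked N x y.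
Proof.
move=> /subsetP MN [|[s [t [sM tM xs yt c]]]]; first by left.
right; exists s, t; split; try exact: MN; try by [].
apply: connect_sub c => a b /and3P[aM bM ab].
by apply: connect1; rewrite /inner !MN.
Qed.

Lemma sub_down S : S \subset down S.
Proof. by apply/subsetP => x xS; rewrite inE; apply/existsP; exists x;
  rewrite xS /=. Qed.

Lemma downP S x : reflect (exists2 s, s \in S & connect step x s) (x \in down
  S).
Proof. by rewrite inE; apply: exists_inP. Qed.

Lemma down_closed S x y : connect step x y -> y \in down S -> x \in down S.
Proof.
by move=> xy /downP[s sS ys]; apply/downP; exists s => //;
  apply: connect_trans ys.
Qed.

Lemma line_connect x y : line x y -> connect step x y.
Proof. by move=> xy; apply: connect1; rewrite /step xy. Qed.

Lemma arrow_connect x y : arrow x y -> connect step x y.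
Proof. by move=> xy; apply: connect1; rewrite /step xy orbT. Qed.

Lemma down_line S x y : line x y -> (x \in down S) = (y \in down S).
Proof.
move=> xy; apply/idP/idP; apply: down_closed; apply: line_connect => //.
by rewrite lineC.
Qed.

End Relations.

(** * Rerouting connecting walks *)

Section Reach.
Variables (V : finType) (G : graph V) (A C : {set V}).
Implicit Types (e f : edge G) (x y z : V) (h c : bool).
Local Notation R := (@reach V G A C).
Local Notation line := (line G).
Local Notation arrow := (arrow G).
Local Notation arc := (arc G).
Local Notation down := (down G).
Local Notation le := (connect (step G)).

Lemma arrow_ends e x y : is_arrow e -> joins e x y ->
  [/\ end1 e = x, end2 e = y, arrowhead_at e x = false & arrowhead_at e y]
  \/ [/\ end1 e = y, end2 e = x, arrowhead_at e x & arrowhead_at e y = false].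
Proof.
rewrite /is_arrow /joins /arrowhead_at; have := loopless e.
case: (etype e) => // ne _ /orP[] /andP[/eqP<- /eqP<-]; [left|right];
  by split=> //; apply/negbTE; rewrite eq_sym // eq_sym.
Qed.

Lemma arc_ends e x y : is_arc e -> joins e x y ->
  arrowhead_at e x /\ arrowhead_at e y.
Proof.
rewrite /is_arc /joins /arrowhead_at; case: (etype e) => // _.
by case/orP => /andP[-> ->]; rewrite ?orbT.
Qed.

Lemma reach_lineR x y h c : R x h c -> line x y -> R y h (c || (y \in C)).
Proof. by move=> rx /asboolP[e el exy]; apply: reach_line rx el exy. Qed.

Lemma reach_arrow x y h : R x h false -> arrow x y -> R y true (y \in C).
Proof.
move=> rx /asboolP[e ea [ex ey]].
have exy: joins e x y by rewrite /joins ex ey !eqxx.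
case: (arrow_ends ea exy) => [[_ _ hx hy]|[Ey _ _ _]]; last first.
  by have := loopless e; rewrite ey Ey eqxx.
rewrite -hy; apply: reach_exit rx _ exy _; last by rewrite /exit_ok hx andbF.
by move: ea; rewrite /is_arrow /is_line; case: etype.
Qed.

(* The section of [x] may be left through an edge with an arrowhead at [x]. *)
Definition exits x := exists h, R x h h.

Lemma exits_arrow x y : exits x -> arrow y x -> R y false (y \in C).
Proof.
case=> h rx /asboolP[e ea [ey ex]].
have exy: joins e x y by rewrite /joins ex ey !eqxx orbT.
case: (arrow_ends ea exy) => [[Ex _ _ _]|[_ _ hx hy]].
  by have := loopless e; rewrite ex Ex eqxx.
rewrite -hy; apply: reach_exit rx _ exy _.
  by move: ea; rewrite /is_arrow /is_line; case: etype.
by rewrite /exit_ok hx andbT; case: (h).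
Qed.

Lemma exits_arc x y : exits x -> arc x y -> R y true (y \in C).
Proof.
case=> h rx /asboolP[e ea exy]; have [hx hy] := arc_ends ea exy.
rewrite -hy; apply: reach_exit rx _ exy _.
  by move: ea; rewrite /is_arc /is_line; case: etype.
by rewrite /exit_ok hx andbT; case: (h).
Qed.

Lemma exits_line x y : exits x -> line x y -> y \notin C -> exits y.
Proof.
by case=> h rx xy /negbTE yC; exists h; have := reach_lineR rx xy;
  rewrite yC orbF.
Qed.

Lemma notin_down S x : x \notin down S -> x \notin S.
Proof. by apply: contra; apply: (subsetP (sub_down G S)). Qed.

(** A section that met [C] joins [x] by lines to a node of [C], and lines are steps both ways. *)
Lemma reach_down x h c : R x h c -> c -> x \in down C.
Proof.
elim=> {x h c} [a _|x y h c e _ IH el exy|x y h c e _ _ _ _ _].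
- exact: (subsetP (sub_down G C)).
- case/orP => [/IH|]; last exact: (subsetP (sub_down G C)).
  by rewrite (@down_line _ _ _ x y) //; apply/asboolP; exists e.
- exact: (subsetP (sub_down G C)).
Qed.

Lemma reach_in x h c : R x h c -> x \in C -> c.
Proof. by elim=> {x h c} // x y h c e _ _ _ _ ->; rewrite orbT. Qed.

(* A detour to a node of C and back turns the section into a collider section
   that meets C. *)
Lemma exits_down x : R x true (x \in C) -> x \in down C -> exits x.
Proof.
move=> rx /downP[s sC /connectP[p xp sE]]; rewrite {s}sE in sC.
elim: p x rx xp sC => [|y p IH] x rx /=; first by move=> _ xC;
  rewrite xC in rx; exists true.
case/andP=> sxy yp sC; have [xC|xC] := boolP (x \in C).
  by rewrite xC in rx; exists true.
rewrite (negbTE xC) in rx; case/orP: sxy => xy.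
  have /IH/(_ yp sC) : R y true (y \in C) := reach_lineR rx xy.
  by rewrite lineC in xy => /exits_line/(_ xy xC).
have /IH/(_ yp sC) ey := reach_arrow rx xy.
by exists false; have := exits_arrow ey xy; rewrite (negbTE xC).
Qed.

(** The path is walked backwards, so every new section is entered at a tail and is a non-collider.
    Its nodes lie above [x], so none is in [C]. *)
Lemma reach_up x y : R y false false -> le x y -> x \notin down C ->
  R x false false.
Proof.
move=> ry /connectP[p xp yE]; rewrite {y}yE in ry.
elim: p x xp ry => [|z p IH] x //= /andP[sxz zp] ry xC.
have zC: z \notin down C.
  by apply: contra xC; apply: down_closed; apply: connect1.
have rz := IH z zp ry zC; have /negbTE xC' := notin_down xC.
case/orP: sxz => xz.
  by rewrite lineC in xz; have := reach_lineR rz xz; rewrite xC'.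
by have := @exits_arrow z x; rewrite xC'; apply=> //; exists false.
Qed.

(** Sections are now left at arrow tails, hence are non-colliders, and again all nodes lie above [x]
    and avoid [C]. *)
Lemma reach_descend x y : R x true false -> le x y -> x \notin down C ->
  R y true false.
Proof.
move=> + /connectP[p xp ->]; elim: p x xp =>
  [|z p IH] x //= /andP[sxz zp] rx xC.
have zC: z \notin down C.
  by apply: contra xC; apply: down_closed; apply: connect1.
apply: IH => //; rewrite -(negbTE (notin_down zC)).
by case/orP: sxz => [/(reach_lineR rx)|/(reach_arrow rx)].
Qed.

(** Inside [down C], sections of the walk from [s] to [t] become colliders that meet [C]. Elsewhere
    the last hypothesis either reaches [x] afresh without an arrowhead, or lets the walk escape to
    the goal [Q]. *)
Lemma reach_across (M : {set V}) (Q : Prop) s t : s \in M -> R s true (s \in C)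
  ->
  connect (inner G M) s t ->
  (forall x, x \in M -> x \notin down C -> R x false false \/ (R x true false
    -> Q)) ->
  Q \/ exits t.
Proof.
move=> sM rs /connectP[p sp tE] HM.
(* In both cases the section of [x] can be left through an arrowhead: by a detour to [C], or as a
   section not entered through one. *)
pose I x := if x \in down C then exists c, R x true c else R x false false.
have headI x : x \in M -> R x true (x \in C) -> Q \/ I x.
  move=> xM rx; rewrite /I; case: ifP => [_|/negbT xC].
    by right; exists (x \in C).
  case: (HM x xM xC) => [|q]; [by right|left; apply: q].
  by move: rx; rewrite (negbTE (notin_down xC)).
have Iexits x : I x -> exits x.
  rewrite /I; case: ifP => [xC [[] rx]|_ rx];
    [by exists true| |by exists false].
  by apply: exits_down xC; case: (x \in C) (reach_in rx) => // /(_ isT).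
suff: forall x, I x -> path (inner G M) x p -> Q \/ I (last x p).
  rewrite tE; case: (headI s sM rs) => [q _|Is /(_ s Is sp)]; first by left.
  by case=> [q|/Iexits]; [left|right].
elim: p {sp tE} => [|y p IH] x Ix /=; first by right.
case/andP=> /and3P[xM yM xy] yp.
suff: Q \/ I y by case=> [q|/IH/(_ yp)//]; left.
case/orP: xy => xy; last exact: headI yM (exits_arc (Iexits x Ix) xy).
right; move: Ix; rewrite /I (down_line _ xy);
  case: ifP => [_ [c rx]|/negbT yC rx].
  by exists (c || (y \in C)); apply: reach_lineR rx xy.
by have := reach_lineR rx xy; rewrite (negbTE (notin_down yC)).
Qed.
End Reach.

(** * Chain mixed graphs *)

Section ChainMixed.
Variables (V : finType) (G : graph V).
Hypothesis G_CMG : CMG G.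
Implicit Types (e f : edge G) (i j x y z t u v : V) (w : steps G).
Implicit Types (A B C M S : {set V}).
Local Notation line := (line G).
Local Notation arrow := (arrow G).
Local Notation arc := (arc G).
Local Notation down := (down G).
Local Notation le := (connect (step G)).

(** Absent dotted lines, such a walk is semi-directed or consists of lines: the two kinds of
    anterior walk. *)
Definition forward w :=
  all (fun s => ~~ is_arc s.1) w &&
  all (fun s => is_arrow s.1 ==> (end2 s.1 == s.2)) w.

Lemma CMG_no_dotted e : ~~ is_dotted e.
Proof. by case: G_CMG. Qed.

Lemma path_walk x p : path (step G) x p ->
  exists w, [/\ is_walk x w (last x p), unzip2 w = p & forward w].
Proof.
elim: p x => [|y p IH] x /=; first by exists [::].
case/andP=> xy /IH[w [wk wp fw]].
suff [e [exy na ea]]: exists e, [/\ joins e x y, ~~ is_arc e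
    & is_arrow e ==> (end2 e == y)].
  exists ((e, y) :: w); split=> //=; first by rewrite wp.
  by move: fw; rewrite /forward /= na ea.
case/orP: xy => /asboolP[e].
  by rewrite /is_line /is_arc /is_arrow => te exy; exists e; case: etype te.
rewrite /is_arrow /is_arc /joins => te [<- <-]; exists e.
by rewrite !eqxx; case: etype te.
Qed.

Lemma walk_le x w y : is_walk x w y -> forward w -> le x y.
Proof.
elim: w x => [|[e z] w IH] x /=; first by move=> -> _.
case=> exz /IH zy; rewrite /forward /= => /andP[/andP[na nw] /andP[ea aw]].
apply: connect_trans (zy _); last by rewrite /forward nw.
apply: connect1; apply/orP; have nd := CMG_no_dotted e.
have [el|nl] := boolP (is_line e); [left|right]; apply/asboolP;
  first by exists e.
have te: is_arrow e.
  by move: na nl nd; rewrite /is_arc /is_line /is_dotted /is_arrow; case: etype.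
exists e => //; move: ea; rewrite te => /eqP ez; split=> //.
case: (arrow_ends te exz) => [[]//|[E _ _ _]].
by move: (loopless e); rewrite E ez eqxx.
Qed.

(** A return path, shortened to repeat no node, closes with the arrow to a semi-directed cycle. *)
Lemma arrow_le_absurd x y : arrow x y -> ~ le y x.
Proof.
case/asboolP=> e te [ex ey] /connectP[p yp xE].
case/shortenP: yp xE => p' yp' up' _ xE.
have [w [wk wp fw]] := path_walk yp'.
case: G_CMG => _; apply; exists x, ((e, y) :: w).
have na: ~~ is_arc e by move: te; rewrite /is_arc /is_arrow; case: etype.
split; last by move: fw; rewrite /semi_directed /forward /= te na ey eqxx.
split=> /=; last by rewrite wp.
  by rewrite /joins ex ey !eqxx xE.
case: w wp {wk fw} => //= p0; move: (loopless e).
by rewrite ex ey xE -p0 eqxx.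
Qed.

Lemma adjacent_cases x y : adjacent G x y ->
  [\/ line x y, arrow x y, arrow y x | arc x y].
Proof.
case=> e exy; have := CMG_no_dotted e; rewrite /is_dotted.
case te: (etype e) => // _.
- by constructor 1; apply/asboolP; exists e; rewrite // /is_line te.
- have ea: is_arrow e by rewrite /is_arrow te.
  by case: (arrow_ends ea exy) => [[]|[]]; [constructor 2|constructor 3];
    apply/asboolP; exists e.
- by constructor 4; apply/asboolP; exists e; rewrite // /is_arc te.
Qed.

(** Turns the conditioning set of the pairwise property into the rest of a down-closed set. *)
Lemma ant_down S : ant G S = down S :\: S.
Proof.
apply/setP => x; rewrite !inE; case xS: (x \in S) => //=.
apply/bigcupP/exists_inP => -[j jS].
  rewrite inE => /asboolP[_ [w [wk w_ant]]]; exists j => //;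
    apply: walk_le wk _.
  rewrite /forward; case/orP: w_ant => [/and3P[_ -> ->] //|].
  by move=> wl; apply/andP; split; apply: sub_all wl => s;
    rewrite /is_line /is_arc /is_arrow; case: etype.
case/connectP=> p /path_walk[w [wk _ fw]] jE; exists j => //.
rewrite inE; apply/asboolP; split; first by move=> E; rewrite E jS in xS.
exists w; split; first by rewrite jE.
rewrite /semi_directed -/(forward w) fw andbT -implyNb -all_predC.
apply/implyP; case/andP: fw => na _ nar; move: (conj na nar).
move/andP; rewrite -all_predI; apply: sub_all => s; have := CMG_no_dotted s.1.
by rewrite /= /is_line /is_arc /is_arrow /is_dotted; case: etype.
Qed.

End ChainMixed.

(** * Maximal classes of the anterior preorder *)

Section TerminalClasses.
Variables (V : finType) (G : graph V).
Hypothesis G_CMG : CMG G.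
Implicit Types (x y z s t u v : V) (A B C M S : {set V}).
Local Notation arrow := (arrow G).
Local Notation down := (down G).
Local Notation linked := (linked G).
Local Notation le := (connect (step G)).

Definition closed_down M := forall x y, le x y -> y \in M -> x \in M.

Definition unlinked M A B := forall a b, a \in A -> b \in B -> ~ linked M a b.

Definition class t : {set V} := [set x | le t x && le x t].

Definition terminal M t := t \in M /\ forall z, z \in M -> le t z -> le z t.

Lemma unlinkedC M A B : unlinked M A B -> unlinked M B A.
Proof. by move=> AB b a bB aA /linkedC; apply: AB. Qed.

Lemma unlinkedS M (N : {set V}) A B : N \subset M -> unlinked M A B ->
  unlinked N A B.
Proof. by move=> NM AB a b aA bB /(linkedS NM); apply: AB. Qed.

Lemma class_refl t : t \in class t.
Proof. by rewrite inE connect0. Qed.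

Lemma class_sub M t : closed_down M -> t \in M -> class t \subset M.
Proof. by move=> cM tM; apply/subsetP => x; rewrite inE => /andP[_ /cM];
  apply. Qed.

Lemma closed_diff_class M t : closed_down M -> terminal M t ->
  closed_down (M :\: class t).
Proof.
move=> cM [tM top] x y xy; rewrite !inE => /andP[nyt yM].
rewrite (cM _ _ xy yM) andbT; apply: contra nyt => /andP[tx xt].
by have ty := connect_trans tx xy; rewrite ty top.
Qed.

(** Take [t] outside [N] with a largest down-set. Since [N] is closed, nodes above [t] are outside
    [N] too, so those in [M] have the same down-set. *)
Lemma exists_terminal M (N : {set V}) : closed_down M -> closed_down N ->
  ~~ (M \subset N) -> exists2 t, terminal M t & [disjoint class t & N].
Proof.
move=> cM cN /subsetPn[x0 x0M x0N].
have P0: x0 \in M :\: N by rewrite inE x0N.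
case: (@arg_maxnP _ x0 (mem (M :\: N)) (fun t => #|down [set t]|) P0) => t /=.
rewrite in_setD => /andP[tN tM] max.
exists t; last first.
  rewrite disjoint_subset; apply/subsetP => x; rewrite !inE => /andP[tx _].
  by apply: contra tN; apply: cN.
split=> // z zM tz; have zN: z \notin N by apply: contra tN; apply: cN.
have sub: down [set t] \subset down [set z].
  apply/subsetP => y /downP[s /set1P-> yt].
  by apply/downP; exists z; rewrite ?set11 //; apply: connect_trans tz.
have /eqP E: down [set t] == down [set z].
  by rewrite eqEcard sub; apply: max; rewrite inE zN.
have: z \in down [set t] by rewrite E (subsetP (sub_down G _)) ?set11.
by case/downP=> s /set1P->.
Qed.

Lemma closed_down_down S : closed_down (down S).
Proof. by move=> x y; apply: down_closed. Qed.

(* Two nodes of a class are joined by a walk of lines: an arrow on the way would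
   lie on a semi-directed cycle. *)
Lemma class_inner M t x y : class t \subset M -> x \in class t ->
  y \in class t -> connect (inner G M) x y.
Proof.
move=> /subsetP tM; rewrite !inE => xt /andP[ty yt].
have /connectP[p xp yE]: le x y by apply: connect_trans ty; case/andP: xt.
elim: p x xp xt yE => [|z p IH] x /=; first by move=> _ _ ->.
case/andP=> xz zp /andP[tx xt] yE.
have zt: le z t by apply: connect_trans yt; apply/connectP; exists p.
have tz: le t z by apply: connect_trans tx (connect1 xz).
apply: connect_trans (IH z zp _ yE); last by rewrite tz zt.
apply: connect1; rewrite /inner !tM ?inE ?tx ?xt ?tz ?zt //=.
case/orP: xz => [-> //|xz].
by case: (arrow_le_absurd G_CMG xz); apply: connect_trans zt tx.
Qed.

(** Nothing in [M] lies strictly above the class. So an edge from [u] to [a] has an arrowhead at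
    [a], and a longer link cannot leave [a] by an arrow: its last edge is an arc, which [inner]
    admits. *)
Lemma linked_class M t u a : closed_down M -> terminal M t -> u \in M ->
  u \notin class t -> a \in class t -> linked M u a ->
  exists s, [/\ s \in M, into G u s & connect (inner G M) s a].
Proof.
move=> cM [tM top] uM nut at_ lua.
have aM: a \in M by apply: subsetP at_; apply: class_sub.
have ncu: le a u -> False.
  move: nut at_; rewrite !inE => nut /andP[ta _] /(connect_trans ta) tu.
  by rewrite tu top in nut.
case: lua => [/(adjacent_cases G_CMG)[]|[s [r [sM rM us ar sr]]]].
- by rewrite lineC => /line_connect/ncu.
- by move=> ua; exists a; rewrite /into ua.
- by move/arrow_connect/ncu.
- by move=> ua; exists a; rewrite /into ua orbT.
exists s; split=> //; apply: connect_trans sr (connect1 _).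
rewrite /inner rM aM; case/orP: ar => [ar|]; last by rewrite arcC => ->;
  rewrite orbT.
case: (arrow_le_absurd G_CMG ar).
move: at_; rewrite inE => /andP[ta at_]; apply: connect_trans (ta).
apply: top rM _; apply: connect_trans (arrow_connect ar).
exact: ta.
Qed.

(** The lines inside the class make it a single collider section between the two links. *)
Lemma linked_through_class M t u v a b : closed_down M -> terminal M t ->
  u \in M -> v \in M -> u \notin class t -> v \notin class t ->
  a \in class t -> b \in class t -> linked M u a -> linked M b v ->
  linked M u v.
Proof.
move=> cM top uM vM nu nv at_ bt /(linked_class cM top uM nu at_)[s [sM us sa]].
move/linkedC/(linked_class cM top vM nv bt) => [r [rM vr rb]].
right; exists s, r; split=> //; apply: connect_trans sa _.
apply: connect_trans (class_inner _ at_ bt) _; last by rewrite inner_connectC.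
by apply: class_sub cM _; case: top.
Qed.

End TerminalClasses.

(** * The induction over closed sets *)

Section SetFacts.
Variable T : finType.
Implicit Types A B : {set T}.

Lemma subset_imp A B : A \subset B -> forall x, (x \in A) ==> (x \in B).
Proof. by move=> /subsetP AB x; apply/implyP/AB. Qed.

Lemma disjoint_nand A B : [disjoint A & B] ->
  forall x, ~~ ((x \in A) && (x \in B)).
Proof.
by move=> AB x; apply/andP => -[xA xB]; rewrite (disjointFr AB xA) in xB.
Qed.

End SetFacts.

Ltac pointwise x :=
  repeat match goal with
  | H : is_true (_ \subset _) |- _ => move: (subset_imp H x); clear H
  | H : is_true (disjoint _ _) |- _ => move: (disjoint_nand H x); clear H
  end;
  rewrite ?inE;
  repeat match goal with
  | |- context [x \in ?A] => case: (x \in A)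
  | |- context [x == ?a] => case: (x == a)
  end; done.

Ltac set_solve :=
  let x := fresh "x" in
  match goal with
  | |- _ = _ => apply/setP => x; pointwise x
  | |- is_true (_ \subset _) => apply/subsetP => x; pointwise x
  | |- is_true (disjoint _ _) =>
      rewrite disjoints_subset; apply/subsetP => x; pointwise x
  end.

Ltac disjoint_solve :=
  rewrite /disjoint4 /disjoint3; repeat (apply/andP; split); set_solve.

Section Graphoid.
Variables (V : finType) (G : graph V) (J : triples V).
Hypothesis G_CMG : CMG G.
Hypothesis J_model : independence_model J.
Hypothesis J_graphoid : compositional_graphoid J.
Hypothesis G_J : pairwise_markov G J.
Implicit Types (x y z s t u v : V) (A B C D M S R : {set V}).
Local Notation down := (down G).
Local Notation linked := (linked G).
Local Notation unlinked := (unlinked G).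
Local Notation class := (class G).
Local Notation terminal := (terminal G).
Local Notation closed_down := (closed_down G).

Definition indep M A B := (A, B, M :\: (A :|: B)) \in J.

Lemma indepC M A B : A \subset M -> B \subset M -> [disjoint A & B] ->
  indep M A B -> indep M B A.
Proof.
move=> AM BM dAB; rewrite /indep setUC; case: J_graphoid => [[sym _ _] _].
apply: (sym _ _ _ _).1; disjoint_solve.
Qed.

(** Intersection adds one node of [B] at a time: since [indep] conditions on all the rest of [M],
    both premises have the required form. *)
Lemma indep_union1 M A B : A \subset M -> B \subset M -> [disjoint A & B] ->
  (forall b, b \in B -> indep M A [set b]) -> indep M A B.
Proof.
case: J_model => _ _ J0; case: J_graphoid => _ [_ inter _].
have [n] := ubnP #|B|; elim: n B => // n IH B Bn AM BM dAB H.
have [->|[b bB]] := set_0Vmem B.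
  by apply: J0; rewrite setU0; set_solve.
have sB : B :\ b \subset B by apply: subsetDl.
have sb : [set b] \subset B by rewrite sub1set.
have db : [disjoint [set b] & B :\ b].
  by rewrite disjoints_subset; apply/subsetP => x; rewrite !inE => ->.
have {}IH : indep M A (B :\ b).
  apply: IH; first by move: Bn; rewrite (cardsD1 b B) bB.
  - by [].
  - set_solve.
  - set_solve.
  - by move=> c /setD1P[_]; apply: H.
have Hb := H b bB.
have BE : B = (B :\ b) :|: [set b] by rewrite setUC setD1K.
rewrite /indep {1}BE; move: IH Hb BE; rewrite /indep.
move: (B :\ b) [set b] sB sb db => B' b' sB sb db IH Hb BE.
apply: inter; last (split; [move: IH|move: Hb]); last 2 first.
- by congr ((_, _, _) \in J); rewrite BE; set_solve.
- by congr ((_, _, _) \in J); rewrite BE; set_solve.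
by disjoint_solve.
Qed.

Lemma indep_union M A B : A \subset M -> B \subset M -> [disjoint A & B] ->
  (forall a b, a \in A -> b \in B -> indep M [set a] [set b]) -> indep M A B.
Proof.
move=> AM BM dAB H; apply: indep_union1 => // b bB.
have bM: [set b] \subset M by rewrite sub1set (subsetP BM).
have Ab: [disjoint A & [set b]] by rewrite disjoint_sym disjoints1 (disjointFl
  dAB).
have bA: [disjoint [set b] & A] by rewrite disjoint_sym.
apply: indepC => //; apply: indep_union1 => // a aA.
apply: indepC; last exact: H.
- by rewrite sub1set (subsetP AM).
- by [].
- by rewrite disjoints1 inE; apply: contraTneq aA => ->;
  rewrite (disjointFl dAB).
Qed.

Definition markov M := forall A B, A \subset M -> B \subset M ->
  [disjoint A & B] -> unlinked M A B -> indep M A B.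

Lemma indep_pairwise M u v : u \in M -> v \in M -> u != v ->
  M = down [set u; v] -> ~ linked M u v -> indep M [set u] [set v].
Proof.
move=> uM vM uv ME nl; rewrite /indep ME -ant_down //.
by apply: G_J => // adj; apply: nl; left.
Qed.

Section Step.
Variable M : {set V}.
Hypothesis M_closed : closed_down M.
Hypothesis IH : forall N : {set V}, N \proper M -> closed_down N -> markov N.

Lemma proper_diff S : S \subset M -> S != set0 -> M :\: S \proper M.
Proof.
move=> SM /set0Pn[x xS]; apply/properP; split; first exact: subsetDl.
by exists x; rewrite ?inE ?xS // (subsetP SM).
Qed.

(** The induction hypothesis for [M :\: S]. Its conditioning set misses [S], which the next two
    lemmas put back. *)
Lemma markov_diff A B S : S \subset M -> S != set0 -> closed_down (M :\: S) ->
  A \subset M -> B \subset M -> [disjoint A & B] ->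
  [disjoint A & S] -> [disjoint B & S] -> unlinked M A B ->
  (A, B, M :\: (A :|: B :|: S)) \in J.
Proof.
move=> SM S0 cS AM BM dAB dAS dBS uAB.
have := IH (proper_diff SM S0) cS (A := A) (B := B).
rewrite /indep setDDl [S :|: _]setUC; apply; try set_solve.
by apply: unlinkedS uAB; apply: subsetDl.
Qed.

(* Composition, then weak union. *)
Lemma indep_compose A B S : A \subset M -> B \subset M -> S \subset M ->
  [disjoint A & B] -> [disjoint A & S] -> [disjoint B & S] ->
  B != set0 -> S != set0 -> closed_down (M :\: B) -> closed_down (M :\: S) ->
  unlinked M A B -> unlinked M A S -> indep M A B.
Proof.
move=> AM BM SM dAB dAS dBS B0 S0 cB cS uAB uAS.
case: J_graphoid => [[_ _ wunion] [_ _ comp]].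
have dSB: [disjoint S & B] by rewrite disjoint_sym.
pose D := M :\: (A :|: B :|: S).
have d4: disjoint4 A B D S.
  by rewrite /D; disjoint_solve.
have ABD : (A, B, D) \in J by apply: markov_diff.
have ASD : (A, S, D) \in J by rewrite /D setUAC; apply: markov_diff.
have [+ _] := wunion _ _ _ _ d4 (comp _ _ _ _ d4 (conj ABD ASD)).
congr ((_, _, _) \in J); rewrite /D; set_solve.
Qed.

(* Contraction, then weak union. *)
Lemma indep_contract A B S : A \subset M -> B \subset M -> S \subset M ->
  [disjoint A & B] -> [disjoint A & S] -> [disjoint B & S] ->
  S != set0 -> closed_down (M :\: S) ->
  unlinked M A B -> indep M A S -> indep M A B.
Proof.
move=> AM BM SM dAB dAS dBS S0 cS uAB iAS.
case: J_graphoid => [[_ _ wunion] [contr _ _]].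
have dSB: [disjoint S & B] by rewrite disjoint_sym.
pose D := M :\: (A :|: B :|: S).
have ABD : (A, B, D) \in J by apply: markov_diff.
have ASD : (A, S, D :|: B) \in J.
  by move: iAS; congr ((_, _, _) \in J); rewrite /D; set_solve.
have d4: disjoint4 A S D B.
  by rewrite /D; disjoint_solve.
have [_ +] := wunion _ _ _ _ d4 ((contr _ _ _ _ d4).1 (conj ASD ABD)).
congr ((_, _, _) \in J); rewrite /D; set_solve.
Qed.

Lemma class_nonempty t : class t != set0.
Proof. by apply/set0Pn; exists t; apply: class_refl. Qed.

(** Otherwise both sets would be linked to the class, and through it to each other. *)
Lemma unlinked_class_or t A B : terminal M t -> A \subset M -> B \subset M ->
  [disjoint A & class t] -> [disjoint B & class t] -> unlinked M A B ->
  unlinked M A (class t) \/ unlinked M B (class t).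
Proof.
move=> top AM BM dA dB uAB; apply: contrapT => /not_orP[nA nB].
apply: nA => a s aA st las; apply: nB => b r bB rt lbr.
apply: (uAB a b aA bB); move/linkedC: lbr => lrb.
apply: (linked_through_class G_CMG M_closed top _ _ _ _ st rt las lrb).
- by rewrite (subsetP AM).
- by rewrite (subsetP BM).
- by rewrite (disjointFr dA aA).
- by rewrite (disjointFr dB bB).
Qed.

Lemma class_inM t : terminal M t -> class t \subset M.
Proof. by case=> tM _; apply: class_sub. Qed.

Lemma down_closed_sub S : S \subset M -> down S \subset M.
Proof.
by move=> /subsetP SM; apply/subsetP => x /downP[s /SM sM xs];
  apply: M_closed xs sM.
Qed.

Lemma class_down_eq t t' S : t' \in class t -> down (t' |: S) = down (t |: S).
Proof.
have sub a b : connect (step G) a b -> down (a |: S) \subset down (b |: S).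
  move=> ab; apply/subsetP => x /downP[s /setU1P[->|sS] xs]; apply/downP.
    by exists b; rewrite ?setU11 //; apply: connect_trans ab.
  by exists s => //; apply/setU1P; right.
by rewrite inE => /andP[tt' t't]; apply/eqP; rewrite eqEsubset !sub.
Qed.

Lemma class_down t S : t \in S -> class t \subset down S.
Proof.
by move=> tS; apply/subsetP => x; rewrite inE => /andP[_ xt]; apply/downP;
  exists t.
Qed.

(** If [t] and [s] generate [M], so does any pair of representatives, and the pairwise property
    applies. Otherwise there is a third maximal class; composition is available because removing any
    of these classes leaves a down-closed set. *)
Lemma indep_class_class t s : terminal M t -> terminal M s ->
  [disjoint class t & class s] -> unlinked M (class t) (class s) ->
  indep M (class t) (class s).
Proof.
move=> tT sT dts uts; have [tM sM] := (class_inM tT, class_inM sT).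
have [MN|/(exists_terminal M_closed (@closed_down_down _ G _))[r rT dr]] :=
    boolP (M \subset down [set t; s]).
  apply: indep_union => // t' s' t't s's; apply: indep_pairwise.
  - exact: (subsetP tM).
  - exact: (subsetP sM).
  - by apply: contraTneq t't => ->; rewrite (disjointFl dts).
  - apply/eqP; rewrite eqEsubset down_closed_sub; last first.
      by rewrite subUset !sub1set (subsetP tM) ?(subsetP sM).
    by rewrite (class_down_eq _ t't) setUC (class_down_eq _ s's) setUC MN.
  - exact: uts.
have rM := class_inM rT.
have dtr: [disjoint class t & class r].
  by rewrite disjoint_sym; apply: disjointWr dr; apply: class_down;
    rewrite !inE eqxx.
have dsr: [disjoint class s & class r].
  by rewrite disjoint_sym; apply: disjointWr dr; apply: class_down;
    rewrite !inE eqxx orbT.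
have dst: [disjoint class s & class t] by rewrite disjoint_sym.
have cl := closed_diff_class M_closed; have ne := class_nonempty.
case: (unlinked_class_or rT tM sM dtr dsr uts) => [utr|usr].
  by apply: (@indep_compose _ _ (class r)) => //; apply: cl.
apply: indepC => //; apply: (@indep_compose _ _ (class r)) => //; try exact: cl.
exact: unlinkedC.
Qed.

(** A single node need not be removable. If [u] is unlinked to the extra class, composition removes
    only classes; if [class t] is, contraction uses the independence of the two classes. *)
Lemma indep_node_class t u : terminal M t -> u \in M -> u \notin class t ->
  unlinked M [set u] (class t) -> indep M [set u] (class t).
Proof.
move=> tT uM ut uut; have tM := class_inM tT.
have uM1: [set u] \subset M by rewrite sub1set.
have dut: [disjoint [set u] & class t] by rewrite disjoints1.
have dtu: [disjoint class t & [set u]] by rewrite disjoint_sym.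
have [MN|/(exists_terminal M_closed (@closed_down_down _ G _))[r rT dr]] :=
    boolP (M \subset down [set t; u]).
  apply: indep_union => // u' t' /set1P-> t't; apply: indep_pairwise => //.
  - exact: (subsetP tM).
  - by apply: contraNneq ut => ->.
  - apply/eqP; rewrite eqEsubset down_closed_sub; last first.
      by rewrite subUset !sub1set uM (subsetP tM).
    by rewrite setUC (class_down_eq _ t't) MN.
  - by apply: uut => //; apply: set11.
have rM := class_inM rT.
have dtr: [disjoint class t & class r].
  by rewrite disjoint_sym; apply: disjointWr dr; apply: class_down;
    rewrite !inE eqxx.
have dur: [disjoint [set u] & class r].
  rewrite disjoint_sym; apply: disjointWr dr.
  by rewrite sub1set (subsetP (sub_down G _)) // !inE eqxx orbT.
have cl := closed_diff_class M_closed; have ne := class_nonempty.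
case: (unlinked_class_or rT uM1 tM dur dtr uut) => [uur|utr].
  by apply: (@indep_compose _ _ (class r)) => //; apply: cl.
apply: indepC => //; apply: (@indep_contract _ _ (class r)) => //.
- exact: cl.
- exact: unlinkedC.
- exact: indep_class_class.
Qed.

(** Neither node need be removable, so only contraction is used, with the node and class case as its
    premise. *)
Lemma indep_node_node u v : u \in M -> v \in M -> u != v -> ~ linked M u v ->
  indep M [set u] [set v].
Proof.
move=> uM vM uv luv.
have uM1: [set u] \subset M by rewrite sub1set.
have vM1: [set v] \subset M by rewrite sub1set.
have duv: [disjoint [set u] & [set v]] by rewrite disjoints1 inE.
have dvu: [disjoint [set v] & [set u]] by rewrite disjoint_sym.
have uuv: unlinked M [set u] [set v] by move=> a b /set1P-> /set1P->.
have [MN|/(exists_terminal M_closed (@closed_down_down _ G _))[r rT dr]] :=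
    boolP (M \subset down [set u; v]).
  apply: indep_pairwise => //; apply/eqP.
  by rewrite eqEsubset MN down_closed_sub // subUset !sub1set uM.
have rM := class_inM rT.
have [dur dvr]: [disjoint [set u] & class r] /\ [disjoint [set v] & class r].
  by split; rewrite disjoint_sym; apply: disjointWr dr;
    rewrite sub1set (subsetP (sub_down G _)) // !inE eqxx ?orbT.
have cl := closed_diff_class M_closed; have ne := class_nonempty.
case: (unlinked_class_or rT uM1 vM1 dur dvr uuv) => [uur|uvr].
  apply: (@indep_contract _ _ (class r)) => //; first exact: cl.
  by apply: indep_node_class => //; move: dur; rewrite disjoints1.
apply: indepC => //; apply: (@indep_contract _ _ (class r)) => //.
- exact: cl.
- exact: unlinkedC.
- by apply: indep_node_class => //; move: dvr; rewrite disjoints1.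
Qed.

End Step.

Lemma markov_closed M : closed_down M -> markov M.
Proof.
have [n] := ubnP #|M|; elim: n M => // n IHn M Mn cM A B AM BM dAB uAB.
apply: indep_union => // a b aA bB; apply: indep_node_node => //.
- by move=> N /proper_card NM cN; apply: IHn => //; apply: leq_trans NM _.
- exact: (subsetP AM).
- exact: (subsetP BM).
- by apply: contraTneq aA => ->; rewrite (disjointFl dAB).
- exact: uAB.
Qed.

End Graphoid.

(** * The global Markov property *)

Section GlobalMarkov.
Variables (V : finType) (G : graph V) (A B C : {set V}).
Hypothesis G_CMG : CMG G.
Implicit Types (x y z s t u v : V).
Local Notation R := (@reach V G A C).
Local Notation down := (down G).
Local Notation M := (down (A :|: B :|: C)).

Hypothesis A_C : [disjoint A & C].
Hypothesis B_unreached : forall b h, b \in B -> ~ R b h false.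

(** A node of [M] outside [down C] lies below [A] or [B]. Below [A] it is reached by walking back
    from [A]; below [B], entering it through an arrowhead would allow a descent to [B]. *)
Lemma unreached_across s t : s \in M -> R s true (s \in C) ->
  connect (inner G M) s t -> exits G A C t.
Proof.
move=> sM rs st; case: (reach_across (Q := False) sM rs st) => // x.
case/downP=> a + xa xC; rewrite -setUA !inE => /or3P[aA|bB|aC].
- left; apply: reach_up xa xC.
  by have := @reach_start V G A C a aA; rewrite (disjointFr A_C aA).
- by right=> rx; apply: (B_unreached bB (reach_descend rx xa xC)).
- by case/negP: xC; apply/downP; exists a.
Qed.

Lemma reached_linked u v h : u \in M -> v \notin C ->
  R u h false -> linked G M u v -> exists h', R v h' false.
Proof.
move=> uM vC ru; have uC: u \notin C by apply/negP => /(reach_in ru).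
(* If [u] was entered through an arrowhead, the trivial walk from [u] to itself is used. *)
have eu : exits G A C u.
  case: h ru => ru; last by exists false.
  by apply: (@unreached_across u u) => //; rewrite (negbTE uC).
case=> [/(adjacent_cases G_CMG)[uv|uv|uv|uv]|[s [t [sM tM us vt st]]]].
- by exists h; have := reach_lineR ru uv; rewrite (negbTE vC).
- by exists true; have := reach_arrow ru uv; rewrite (negbTE vC).
- by exists false; have := exits_arrow eu uv; rewrite (negbTE vC).
- by exists true; have := exits_arc eu uv; rewrite (negbTE vC).
have et: exits G A C t.
  apply: (unreached_across sM _ st).
  by case/orP: us => [/(reach_arrow ru)|/(exits_arc eu)].
case/orP: vt => vt.
  by exists false; have := exits_arrow et vt; rewrite (negbTE vC).
by rewrite arcC in vt; exists true; have := exits_arc et vt;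
  rewrite (negbTE vC).
Qed.

End GlobalMarkov.

Lemma pairwise_global (V : finType) (G : graph V) (J : triples V) :
  CMG G -> independence_model J -> compositional_graphoid J ->
  pairwise_markov G J -> global_markov G J.
Proof.
move=> G_CMG J_model J_graphoid G_J A B C /and3P[dAB dAC dBC].
move/(separatedP (CMG_no_dotted G_CMG)) => sep.
have Bun b h : b \in B -> ~ reach G A C b h false.
  by move=> bB rb; apply: sep; exists b => //; exists h.
pose M := down G (A :|: B :|: C).
have /subsetP subM : A :|: B :|: C \subset M by apply: sub_down.
have CM: C \subset M by apply/subsetP => x xC; rewrite subM // inE xC orbT.
(* The reached nodes [A'] and the unreached nodes [B'] partition [M :\: C], so that [indep]
   conditions exactly on [C]. *)
pose A' := [set x in M :\: C | `[< exists h, reach G A C x h false >]].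
pose B' := M :\: C :\: A'.
have AA': A \subset A'.
  apply/subsetP => a aA; have aC := disjointFr dAC aA.
  rewrite inE in_setD aC subM ?inE ?aA //=; apply/asboolP; exists false.
  by have := @reach_start V G A C a aA; rewrite aC.
have BB': B \subset B'.
  apply/subsetP => b bB; rewrite !in_setD inE in_setD (disjointFr dBC bB) subM
    ?inE ?bB ?orbT //= andbT.
  by apply/asboolP => -[h]; apply: Bun.
have A'M: A' \subset M :\: C by apply/subsetP => x; rewrite inE => /andP[].
have uA'B' : unlinked G M A' B'.
  move=> a b; rewrite inE in_setD => /andP[/andP[_ aM] /asboolP[h ra]].
  rewrite !in_setD => /andP[nb /andP[bC bM]] lab; case/negP: nb.
  rewrite inE in_setD bC bM; apply/asboolP.
  apply: (reached_linked G_CMG dAC Bun aM bC ra lab).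
have: indep J M A' B'.
  apply: (markov_closed G_CMG J_model J_graphoid G_J (@closed_down_down _ _ _))
    => //.
  - by apply: subset_trans A'M (subsetDl _ _).
  - by rewrite /B' setDDl; apply: subsetDl.
  - by rewrite /B'; move: (A') => X; set_solve.
rewrite /indep; have -> : M :\: (A' :|: B') = C.
  by rewrite /B'; move: (M) (A') A'M CM => N X XN CN; set_solve.
case: J_graphoid => [[sym dec _] _].
have dA'C: [disjoint A' & C] by move: (M) (A') A'M => N X XN; set_solve.
have dB'C: [disjoint B' & C] by rewrite /B'; move: (A') => X; set_solve.
have dA'B': [disjoint A' & B'] by rewrite /B'; move: (A') => X; set_solve.
clear uA'B' Bun sep; move: (A') (B') AA' BB' dA'C dB'C dA'B' =>
  X Y AX BY dXC dYC dXY.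
have EX: X = A :|: (X :\: A) by set_solve.
have EY: Y = B :|: (Y :\: B) by set_solve.
move=> iXY; have [iXB _]: (X, B, C) \in J /\ (X, Y :\: B, C) \in J.
  by apply: dec; [disjoint_solve|rewrite -EY].
have iBX: (B, X, C) \in J by apply: (sym _ _ _ _).1 iXB; disjoint_solve.
have [iBA _]: (B, A, C) \in J /\ (B, X :\: A, C) \in J.
  by apply: dec; [disjoint_solve|rewrite -EX].
by apply: (sym _ _ _ _).1 iBA; disjoint_solve.
Qed.

(** * Maximality *)

Section ReachAddEdge.
Variables (V : finType) (G : graph V) (i j : V) (ij : i != j) (te : edge_type).
Hypothesis te_head : te = Arrow \/ te = Arc.
Local Notation G' := (add_edge G te ij).
Local Notation new := (None : edge G').

Lemma new_not_line : ~~ is_line new.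
Proof. by case: te_head; rewrite /is_line /= => ->. Qed.

(** The hypotheses simulate the new edge inside [G] in both directions, arriving in the very same
    state. *)
Lemma reach_add_edge (A C : {set V}) :
  (forall h c, reach G A C i h c -> exit_ok h c new i ->
     reach G A C j (arrowhead_at new j) (j \in C)) ->
  (forall h c, reach G A C j h c -> exit_ok h c new j ->
     reach G A C i (arrowhead_at new i) (i \in C)) ->
  forall x h c, reach G' A C x h c <-> reach G A C x h c.
Proof.
move=> fwd bwd x h c; split; elim=> {x h c}.
- by move=> a; apply: reach_start.
- move=> x y h c [e|] _ rx el exy; first exact: (reach_line (e := e) rx el exy).
  by case/negP: new_not_line.
- move=> x y h c [e|] _ rx el exy ex.
    exact: (reach_exit (e := e) rx el exy ex).
  case/orP: exy => /andP[/eqP Ei /eqP Ej]; move: rx ex; rewrite -Ei -Ej;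
    [exact: fwd|exact: bwd].
- by move=> a; apply: reach_start.
- move=> x y h c e _ rx el exy;
  exact: (reach_line (e := Some e : edge G') rx el exy).
- move=> x y h c e _ rx el exy ex.
  exact: (reach_exit (e := Some e : edge G') rx el exy ex).
Qed.

Lemma induced_model_add_edge : (forall e : edge G, ~~ is_dotted e) ->
  (forall A C : {set V}, forall x h c, reach G' A C x h c <-> reach G A C x h
    c) ->
  induced_model G' = induced_model G.
Proof.
move=> nd same.
have nd' (e : edge G') : ~~ is_dotted e.
  by case: e => [e|]; [exact: nd|rewrite /is_dotted /=; case: te_head => ->].
apply/setP => -[[A B] C]; rewrite !inE; apply: asbool_equiv_eq.
split=> -[d /separatedP sep]; split=> //; apply/separatedP => //.
  by move/(_ nd'): sep; apply: contra_not => -[b bB [h rb]]; exists b => //;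
    exists h; apply/same.
by move/(_ nd): sep; apply: contra_not => -[b bB [h rb]]; exists b => //;
  exists h; apply/same.
Qed.

End ReachAddEdge.

(** * Links between non-adjacent nodes *)

Section Inducing.
Variables (V : finType) (G : graph V).
Hypothesis G_CMG : CMG G.
Implicit Types (x y z s t u v i j : V) (A B C M : {set V}).
Local Notation line := (line G).
Local Notation arrow := (arrow G).
Local Notation arc := (arc G).
Local Notation down := (down G).
Local Notation le := (connect (step G)).

Lemma reach_exits A C x h c : reach G A C x h c -> (if h then c else ~~ c) ->
  exits G A C x.
Proof. by case: h; case: c => // r _; [exists true|exists false]. Qed.

Lemma exits_up A C x y : exits G A C y -> le x y -> x \notin down C ->
  reach G A C x false false.
Proof.
case=> -[] ry xy xC; last exact: reach_up ry xy xC.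
by case/negP: xC; apply: down_closed xy (reach_down ry isT).
Qed.

Lemma reach_notin_down A C x y : reach G A C x true false -> le x y ->
  x \notin down C -> reach G A C y true (y \in C).
Proof.
move=> rx xy xC; have ry := reach_descend rx xy xC.
by case yC: (y \in C) => //; have := reach_in ry yC.
Qed.

(** Simulates an arc. Outside [down C], a node below [i] is reached by walking back from [i]; one
    below [j] entered through an arrowhead descends to [j], which is the goal [Q]. *)
Lemma across_arcs A C i j s t : s \in down [set i; j] -> arc i s -> arc j t ->
  connect (inner G (down [set i; j])) s t -> exits G A C i ->
  reach G A C j true (j \in C).
Proof.
move=> sM is_ jt st ei; have rs := exits_arc ei is_.
rewrite arcC in jt.
have [|//|/exits_arc] := reach_across (Q := reach G A C j true (j \in C)) sM rs
  st; last exact.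
move=> x /downP[k /set2P[]-> xk] xC; first by left; apply: exits_up ei xk xC.
by right=> rx; apply: reach_notin_down rx xk xC.
Qed.

(** Simulates an arrow from [i] to [j]. As [le i j], every node of the down-set is below [j] and can
    descend to it. *)
Lemma across_arrow A C i j s t h : s \in down [set i; j] -> le i j ->
  arrow i s -> arc j t -> connect (inner G (down [set i; j])) s t ->
  reach G A C i h false -> reach G A C j true (j \in C).
Proof.
move=> sM ij is_ jt st ri; have rs := reach_arrow ri is_.
rewrite arcC in jt.
have [|//|/exits_arc] := reach_across (Q := reach G A C j true (j \in C)) sM rs
  st; last exact.
move=> x /downP[k kij xk] xC; right=> rx; apply: reach_notin_down rx _ xC.
by case/set2P: kij xk => -> // xi; apply: connect_trans ij.
Qed.

Lemma across_arrow_back A C i j s t : t \in down [set i; j] -> le i j ->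
  arrow i s -> arc j t -> connect (inner G (down [set i; j])) s t ->
  exits G A C j -> reach G A C i false (i \in C).
Proof.
move=> tM ij is_ jt; rewrite inner_connectC => ts ej;
  have rt := exits_arc ej jt.
have [|//|es] := reach_across (Q := False) tM rt ts;
  last exact: exits_arrow es is_.
move=> x /downP[k kij xk] xC; left; apply: exits_up ej _ xC.
by case/set2P: kij xk => -> // xi; apply: connect_trans ij.
Qed.

Lemma maximal_not_arcs i j s t : maximal G -> ~ adjacent G i j -> i != j ->
  s \in down [set i; j] -> t \in down [set i; j] -> arc i s -> arc j t ->
  ~ connect (inner G (down [set i; j])) s t.
Proof.
move=> Gmax nadj ij sM tM is_ jt st; apply: (Gmax i j ij Arc nadj).
apply: induced_model_add_edge; [by right|exact: CMG_no_dotted|move=> A C].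
apply: reach_add_edge => [|h c r ex|h c r ex]; first by right.
  have -> : arrowhead_at (None : edge (add_edge G Arc ij)) j by rewrite
    /arrowhead_at /= eqxx orbT.
  apply: (across_arcs sM is_ jt st).
  move: ex; rewrite /exit_ok /arrowhead_at /= eqxx andbT; apply: reach_exits r.
have -> : arrowhead_at (None : edge (add_edge G Arc ij)) i by rewrite
  /arrowhead_at /= eqxx.
rewrite setUC in sM tM st; rewrite inner_connectC in st.
apply: (across_arcs tM jt is_ st).
move: ex; rewrite /exit_ok /arrowhead_at /= eqxx orbT andbT;
  apply: reach_exits r.
Qed.

Lemma maximal_not_arrow i j s t : maximal G -> ~ adjacent G i j -> i != j ->
  s \in down [set i; j] -> t \in down [set i; j] -> arrow i s -> arc j t ->
  ~ connect (inner G (down [set i; j])) s t.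
Proof.
move=> Gmax nadj ij sM tM is_ jt st.
(* If [s] were below [i], the arrow from [i] to [s] would lie on a semi-directed cycle; hence [s] is
   below [j]. *)
have le_ij : le i j.
  case/downP: (sM) => k /set2P[]-> sk.
    by case: (arrow_le_absurd G_CMG is_).
  exact: connect_trans (arrow_connect is_) sk.
apply: (Gmax i j ij Arrow nadj).
apply: induced_model_add_edge; [by left|exact: CMG_no_dotted|move=> A C].
have nji : (j == i) = false by rewrite eq_sym (negbTE ij).
apply: reach_add_edge => [|h c r ex|h c r ex]; first by left.
  have -> : arrowhead_at (None : edge (add_edge G Arrow ij)) j by rewrite
    /arrowhead_at /= eqxx.
  move: ex; rewrite /exit_ok /arrowhead_at /= nji andbF => c0.
  by apply: (across_arrow (h := h) sM le_ij is_ jt st); move: r;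
    rewrite (negbTE c0).
have -> : arrowhead_at (None : edge (add_edge G Arrow ij)) i = false by rewrite
  /arrowhead_at /= nji.
apply: (across_arrow_back tM le_ij is_ jt st).
move: ex; rewrite /exit_ok /arrowhead_at /= eqxx andbT; apply: reach_exits r.
Qed.

Lemma maximal_not_linked i j : maximal G -> i != j -> ~ adjacent G i j ->
  ~ linked G (down [set i; j]) i j.
Proof.
move=> Gmax ij nadj [//|[s [t [sM tM is_ jt st]]]].
have ji: j != i by rewrite eq_sym.
have nadj': ~ adjacent G j i by move/adjacentC.
case/orP: is_ => is_; case/orP: jt => jt.
(* Two arrows: [s] must lie below [j] and [t] below [i], which closes a semi-directed cycle. *)
- case/downP: (sM) => k /set2P[]-> sk;
  first by case: (arrow_le_absurd G_CMG is_).
  case/downP: (tM) => k' /set2P[]-> tk;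
    last by case: (arrow_le_absurd G_CMG jt).
  apply: (arrow_le_absurd G_CMG is_); apply: connect_trans sk _.
  exact: connect_trans (arrow_connect jt) tk.
- exact: maximal_not_arrow st.
- rewrite setUC in sM tM st; rewrite inner_connectC in st.
  exact: maximal_not_arrow st.
- exact: maximal_not_arcs st.
Qed.

(** A connecting walk that leaves [M] never returns: collider sections meeting [C] lie in [M], and
    lines and outgoing arrows from outside [M] stay outside. Inside [M], only [i] and [j] avoid [C],
    so inner sections are colliders. *)
Lemma reach_ant_linked i j h : i != j -> ~ adjacent G i j ->
  reach G [set i] (ant G [set i; j]) j h false -> linked G (down [set i;
    j]) i j.
Proof.
move=> ij nadj; rewrite ant_down //.
set M := down [set i; j]; set C := M :\: _ => rj.
apply: contrapT => nl.
pose S x := exists s, [/\ s \in M, into G i s & connect (inner G M) s x].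
have iM: i \in M by rewrite (subsetP (sub_down G _)) // !inE eqxx.
have jM: j \in M by rewrite (subsetP (sub_down G _)) // !inE eqxx orbT.
have cM x y : le x y -> y \in M -> x \in M by apply: down_closed.
have CM x : x \in down C -> x \in M.
  by case/downP=> c cC xc; apply: cM xc _; move: cC; rewrite in_setD => /andP[].
have MC x : x \in M -> x \notin C -> x = i \/ x = j.
  by move=> xM; rewrite in_setD xM andbT negbK => /set2P.
have nP x : x \in M -> S x -> into G j x -> False.
  by move=> xM [s [sM is_ sx]] jx; apply: nl; right; exists s, x.
(* After an arrowhead, a node of [M] ends a linking walk begun at [i]. Otherwise a section that has
   not met [C] is still at [i], and one that has met [C] can never be left, so nothing is claimed of
   it. *)
suff inv x h' c : reach G [set i] C x h' c ->
    if h' then (x \in M -> S x) /\ (~~ c -> x != j) else ~~ c -> x = i.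
  by case: h rj => /inv; [case=> _ /(_ isT); rewrite eqxx|move/(_ isT)/eqP;
    rewrite eq_sym (negbTE ij)].
elim=> {x h' c} [a /set1P-> //|x y h' c e rx IH el exy|x y h' c e rx IH nel exy
  ex].
  have xy: line x y by apply/asboolP; exists e.
  have xyM: (x \in M) = (y \in M) by apply: down_line.
  case: h' rx IH => rx IH; last first.
    rewrite negb_or => /andP[/IH xi yC]; rewrite xi in xy xyM.
    case: (MC y _ yC) => [|//|yj]; first by rewrite -xyM.
    by case: nadj; rewrite -yj; apply: line_adjacent.
  have [IS Ij] := IH; split=> [yM|].
    have xM: x \in M by rewrite xyM.
    have [s [sM is_ sx]] := IS xM; exists s; split=> //.
    by apply: connect_trans sx (connect1 _); rewrite /inner xM yM xy.
  rewrite negb_or => /andP[c0 yC]; apply/eqP => yj.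
  have xC: x \notin C by apply/negP => /(reach_in rx); apply/negP.
  case: (MC x _ xC) => [|xi|xj]; first by rewrite xyM yj.
    by case: nadj; rewrite -yj -xi; apply: line_adjacent.
  by have := Ij c0; rewrite xj eqxx.
have adj : adjacent G x y by exists e.
have ends : [\/ [/\ arrow x y, arrowhead_at e x = false & arrowhead_at e y],
    [/\ arrow y x, arrowhead_at e x & arrowhead_at e y = false]
  | [/\ arc x y, arrowhead_at e x & arrowhead_at e y]].
  have := CMG_no_dotted G_CMG e; move: nel; rewrite /is_line /is_dotted.
  case te: (etype e) => // _ _.
    have ea: is_arrow e by rewrite /is_arrow te.
    by case: (arrow_ends ea exy) => [[]|[]] ? ? ? ?;
      [constructor 1|constructor 2];
      split=> //; apply/asboolP; exists e.
  have ea: is_arc e by rewrite /is_arc te.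
  by have [? ?] := arc_ends ea exy; constructor 3; split=> //; apply/asboolP;
    exists e.
case: ends ex => [[xy hx hy]|[yx hx hy]|[xy hx hy]];
  rewrite /exit_ok hx hy ?andbF ?andbT => ex.
(* Leaving at a tail makes the section of [x] a non-collider, so [x] in [M] is [i] or [j], and the
   invariant excludes [j]. *)
- have xi : x \in M -> x = i.
    have xC: x \notin C by apply/negP => /(reach_in rx); apply/negP.
    move=> xM; case: h' rx IH => rx IH; last exact: IH.
    by case: (MC x xM xC) => // xj; case: IH => _ /(_ ex); rewrite xj eqxx.
  have le_xy := arrow_connect xy.
  split=> [yM|_]; last first.
    by apply/eqP => yj; case: nadj; rewrite -yj -(xi _) //; apply: cM le_xy _;
      rewrite yj.
  by exists y; split=> //; rewrite /into -(xi _) ?xy //; apply: cM le_xy yM.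
(* The section left at an arrowhead is a collider meeting [C], or [x] is [i]; either way [x] is in
   [M]. *)
- move=> yC; have xM: x \in M.
    case: h' c ex rx IH => -[] // _ rx IH; first exact/CM/(reach_down rx).
    by rewrite IH.
  case: (MC y _ yC) => [|//|yj]; first exact: cM (arrow_connect yx) xM.
  case: h' c ex rx IH => -[] // _ rx IH.
    by case: (nP x xM); [case: IH => /(_ xM)|rewrite -yj /into yx].
  by case: nadj; apply: adjacentC; rewrite -yj -(IH isT); apply: arrow_adjacent.
case: h' c ex rx IH => -[] // _ rx IH.
  have xM: x \in M by apply/CM/(reach_down rx).
  have [/(_ xM) Sx _] := IH; split=> [yM|_].
    case: Sx => s [sM is_ sx]; exists s; split=> //.
    by apply: connect_trans sx (connect1 _); rewrite /inner xM yM xy orbT.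
  by apply/eqP => yj; apply: (nP x xM Sx); rewrite -yj /into arcC xy orbT.
have xi := IH isT; rewrite xi in xy adj; split=> [yM|_].
  by exists y; split=> //; rewrite /into xy orbT.
by apply/eqP => yj; case: nadj; rewrite -yj.
Qed.

End Inducing.

Theorem theorem4 (V : finType) (G : graph V) (J : triples V)
    (G_CMG : CMG G) (G_max : maximal G)
    (J_model : independence_model J)
    (J_graphoid : compositional_graphoid J) :
  pairwise_markov G J <-> global_markov G J.
Proof.
split; first exact: pairwise_global.
move=> GM i j ij nadj; apply: GM.
  rewrite /disjoint3 disjoints1 inE ij /=; apply/andP.
  split; rewrite disjoints1 !inE eqxx ?orbT //.
apply/(separatedP (CMG_no_dotted G_CMG)) => -[_ /set1P-> [h rj]].
exact: (maximal_not_linked G_CMG G_max ij nadj (reach_ant_linked G_CMG ij nadj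
  rj)).
Qed.
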